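(* Let $F=GF(8)$ be the field with $8$ elements, let $\sigma$ be the field automorphism $\alpha\mapsto\alpha^2$ of $F$, and let $\tau=\sigma^2$, i.e. $\alpha^\tau=\alpha^4$ for $\alpha\in F$. Let $U=F\times F$ as a set, equipped with the group multiplication $(a,b)(c,d)=(a+c,\;b+d+a^\tau c)$. For $s\in F^\times$ let $\varphi_s\in\operatorname{Aut}(U)$ be $\varphi_s(a,b)=(sa,s^5b)$, and let $\sigma\in\operatorname{Aut}(U)$ also denote the automorphism $(a,b)\mapsto(a^2,b^2)$. Let $p=3$, let $t$ be a generator of the multiplicative group $F^\times$, and inside $\operatorname{Aut}(U)$ put $T=\langle\varphi_t\rangle$, $P=\langle\sigma\rangle$ and $K=T\rtimes P$ (a subgroup of $\operatorname{Aut}(U)$). Let $G=U\rtimes K$ be the semidirect product with respect to the natural action of $K\le\operatorname{Aut}(U)$ on $U$; thus $|G|=2^6\cdot 3\cdot 7$ and $P$ is a Sylow $3$-subgroup of $G$. Then $|\mathrm{Irr}_p(G)|=2$ and $l_p(G)=3$.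
   Context: For a finite group $G$ and a prime $p$: $\mathrm{Irr}_p(G)$ denotes the set of complex irreducible characters of $G$ whose degrees are divisible by $p$. For a Sylow $p$-subgroup $P$ of $G$, $l_p(G)$ denotes the length of the longest strictly ascending chain of subgroups $N_G(P)=H_0<H_1<\cdots<H_m=G$ between $N_G(P)$ and $G$, where the length of such a chain is the number $m$ of strict inclusions. The set $U$ with the stated multiplication is a group, and the maps $\varphi_s$ and $\sigma$ are automorphisms of it. *)

(* Defs.v *)
From HB Require Import structures.
From mathcomp Require Import all_boot all_order all_fingroup all_algebra.
From mathcomp Require Import all_solvable all_field all_character.

Set Implicit Arguments.
Unset Strict Implicit.
Unset Printing Implicit Defensive.

Import GRing.Theory GroupScope.

(* Each chi in Irr(G) is represented by its index i : Iirr G, and the map      *)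
(* i |-> 'chi_i is a bijection onto Irr(G); dvdC is divisibility in algC by an  *)
(* algebraic integer multiple, which on natural numbers is the usual one.      *)
Definition Irr_p (p : nat) (gT : finGroupType) (G : {group gT}) :
    {set Iirr G} :=
  [set i : Iirr G | (p %| ('chi_i 1%g)%R)%C].

Definition strict_chain (gT : finGroupType) (H G : {group gT})
    (c : seq {group gT}) : bool :=
  path (fun A B : {group gT} => A \proper B) H c && (last H c == G).

(* The bound on m only makes the maximum finite: see strict_chain_size.        *)
Definition chain_length (gT : finGroupType) (H G : {group gT}) : nat :=
  \max_(m < #|G|.+1 | [exists c : m.-tuple {group gT}, strict_chain H G c]) m.

Lemma strict_chain_size (gT : finGroupType) (H G : {group gT}) c :
  strict_chain H G c -> size c < #|G|.
Proof.
case/andP=> cP /eqP <-; suff: size c + #|H| <= #|last H c|.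
  by apply: leq_trans; rewrite -addn1 leq_add2l cardG_gt0.
elim: c H cP => //= A c IHc H /andP[/proper_card ltHA /IHc].
by apply: leq_trans; rewrite addSnnS leq_add2l.
Qed.

Lemma strict_chainJ (gT : finGroupType) (H G : {group gT}) c x :
  x \in G -> strict_chain H G c ->
  strict_chain (H :^ x)%G G [seq (A :^ x)%G | A : {group gT} <- c].
Proof.
move=> Gx /andP[cP /eqP cG]; apply/andP; split.
  elim: c H cP {cG} => //= A c IHc H /andP[HA /IHc ->].
  by rewrite /proper !conjSg andbT.
by rewrite (last_map (fun A : {group gT} => (A :^ x)%G)) cG -val_eqE /= conjGid.
Qed.

(* Sylow_exists supplies some Sylow p-subgroup; l_pE shows the value does not  *)
(* depend on which one.                                                        *)
Definition l_p (p : nat) (gT : finGroupType) (G : {group gT}) : nat :=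
  chain_length 'N_G(sval (Sylow_exists p G))%G G.

Lemma l_pE (p : nat) (gT : finGroupType) (G P : {group gT}) :
  p.-Sylow(G) P -> l_p p G = chain_length 'N_G(P)%G G.
Proof.
rewrite /l_p; case: (Sylow_exists p G) => Q /= sylQ sylP.
suff leJ (A B : {group gT}) : p.-Sylow(G) A -> p.-Sylow(G) B ->
    chain_length 'N_G(A)%G G <= chain_length 'N_G(B)%G G.
  by apply/eqP; rewrite eqn_leq !leJ.
move=> sylA sylB; have [x Gx defB] := Sylow_trans sylA sylB.
have defNB : 'N_G(B)%G = ('N_G(A) :^ x)%G.
  by apply/val_inj; rewrite /= conjIg conjGid // defB normJ.
apply/bigmax_leqP=> m /existsP[c /(strict_chainJ Gx)].
rewrite -defNB => cB.
by apply: (leq_bigmax_cond m); apply/existsP;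
  exists [tuple of [seq (A0 :^ x)%G | A0 : {group gT} <- c]].
Qed.

(* The hypothesis #|F| = 8 is a parameter of the type because associativity of *)
(* the multiplication needs characteristic 2.                                  *)
Definition U (F : finFieldType) (cardF : #|F| = 8) : Type := (F * F)%type.

Section SuzukiGroup.

Local Open Scope ring_scope.

Variables (F : finFieldType) (cardF : #|F| = 8).

Local Notation U := (U cardF).

HB.instance Definition _ := Finite.copy U (F * F)%type.

Lemma pchar2 : 2%N \in [pchar F].
Proof. exact: (card_finPcharP (n := 3)). Qed.

Lemma sqrD (x y : F) : (x + y) ^+ 2 = x ^+ 2 + y ^+ 2.
Proof. exact: (pFrobenius_autD_comm pchar2 (mulrC x y)). Qed.

Definition tau (x : F) : F := x ^+ 4.

Lemma tauD (x y : F) : tau (x + y) = tau x + tau y.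
Proof. by rewrite /tau !(exprM _ 2 2) !sqrD. Qed.

Definition mulU (u v : U) : U := (u.1 + v.1, u.2 + v.2 + tau u.1 * v.1).

Definition oneU : U := (0, 0).

Definition invU (u : U) : U := (- u.1, - u.2 + tau u.1 * u.1).

Lemma mulUA : associative mulU.
Proof.
move=> [a b] [c d] [e f]; rewrite /mulU /= tauD; congr (_, _).
  by rewrite addrA.
rewrite mulrDr mulrDl !addrA.
by rewrite [RHS](ACl (1 * 2 * 4 * 6 * 3 * 5)).
Qed.

Lemma mul1U : left_id oneU mulU.
Proof. by move=> [a b]; rewrite /mulU /tau /= expr0n mul0r !add0r addr0. Qed.

Lemma mulVU : left_inverse oneU invU mulU.
Proof.
move=> [a b]; rewrite /mulU /invU /oneU /= addNr; congr (_, _).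
have -> : tau (- a) = tau a by rewrite /tau (oppr_pchar2 pchar2).
by rewrite addrAC (addrK_pchar2 pchar2) addNr.
Qed.

HB.instance Definition _ := Finite_isGroup.Build U mulUA mul1U mulVU.

Definition phi_fun (s : {unit F}) (u : U) : U :=
  (val s * u.1, val s ^+ 5 * u.2).

Lemma phi_inj s : injective (phi_fun s).
Proof.
have us : val s \is a GRing.unit by exact: valP.
by move=> [a b] [c d] [/(mulrI us) -> /(mulrI (unitrX 5 us)) ->].
Qed.

Definition sigma_fun (u : U) : U := (u.1 ^+ 2, u.2 ^+ 2).

Lemma sigma_inj : injective sigma_fun.
Proof.
have sqI : injective (fun x : F => x ^+ 2).
  exact: (fmorph_inj (pFrobenius_aut pchar2)).
by move=> [a b] [c d] [/sqI -> /sqI ->].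
Qed.

Definition phi (s : {unit F}) : {perm U} := perm (@phi_inj s).

Definition sigma : {perm U} := perm sigma_inj.

Lemma phi_Aut s : phi s \in Aut [set: U].
Proof.
rewrite inE; apply/andP; split; first by apply/subsetP=> u; rewrite inE.
apply/morphicP=> -[a b] [c d] _ _; rewrite !permE; congr (_, _) => /=.
  by rewrite mulrDr.
by rewrite !mulrDr /tau exprMn [val s ^+ 5]exprSr mulrACA.
Qed.

Lemma sigma_Aut : sigma \in Aut [set: U].
Proof.
rewrite inE; apply/andP; split; first by apply/subsetP=> u; rewrite inE.
apply/morphicP=> -[a b] [c d] _ _; rewrite !permE; congr (_, _) => /=.
  by rewrite sqrD.
by rewrite !sqrD exprMn /tau -!exprM.
Qed.

Variable t : {unit F}.

Definition T : {group {perm U}} := <[phi t]>%G.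

Definition P : {group {perm U}} := <[sigma]>%G.

Definition K : {group {perm U}} := (T <*> P)%G.

Lemma K_Aut : K \subset Aut [set: U].
Proof. by rewrite join_subG !cycle_subG phi_Aut sigma_Aut. Qed.

(* Permutations compose left to right and act on the right, so in G the        *)
(* automorphism a sends x to the conjugate a^-1 * x * a, see sdpair_act.       *)
Definition K_action : groupAction K [set: U] := ([Aut [set: U]] \ K_Aut)%gact.

Definition G : {group sdprod_by K_action} := [set: sdprod_by K_action]%G.

(* The copy of P inside G.                                                     *)
Definition PG : {group sdprod_by K_action} := (sdpair2 K_action @* P)%G.

End SuzukiGroup.

(* Main.v *)
Require Import Defs.
From mathcomp Require Import all_boot all_order all_fingroup all_algebra.
From mathcomp Require Import all_solvable all_field all_character.

Set Implicit Arguments.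
Unset Strict Implicit.
Unset Printing Implicit Defensive.

Import Order.TTheory GRing.Theory Num.Theory GroupScope.

(** Write [N = U T], a normal subgroup of [G] of index 3 and order 448.

    Characters.  If [s != 1], then [phi s] fixes no nontrivial element of [U], so
    the coset of [U] through [phi s] is a single [U]-class
    ([class_rcoset_cent1], [class_f]).  Two things follow.  First, the derived
    subgroup of [G] is [N] ([der1_GG]): it contains [phi t = [~ phi t, sigma]],
    and then every [u = (u phi t) (phi t)^-1] because [u phi t] is conjugate to
    [phi t].  Second, [N] has at most ten classes ([NN_reps]): six outside [U],
    and inside [U] those of the identity, of [(0, 1)], and of [(1, 0)] and
    [(1, 1)], since conjugation by [(c, 0)] adds [c ^ 4 + c] to the second
    coordinate of [(1, d)] and these values form an additive subgroup of index 2
    avoiding 1.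

    Seven irreducible characters of [N] have [U] in their kernel, namely those of
    the cyclic group [N / U]; hence at most three do not, and the squares of their
    degrees add up to 448 - 7 = 441.  Take [chi] irreducible for [G] with [U] not
    in its kernel.  Since [N] has prime index 3, the restriction of [chi] to [N]
    is irreducible or a sum of three distinct characters of equal degree [d].  In
    the second case these are all the characters just mentioned, so that
    [3 d ^ 2 = 441], which has no solution.  So the restriction is irreducible,
    and [chi 1] divides 448 and is prime to 3 ([dvd3_deg_ker]).  The characters of
    degree divisible by 3 are therefore characters of [G / U], of order 21: three
    are linear, as [N] is the derived subgroup, and 21 = 3 + 2 * 9 leaves exactly
    two of degree 3 ([card_Irr_3]).

    Chains.  The normaliser of [P] contains [P] and [z = (1, 0)].  Let [H] contain
    both, and put [V = {x in U | x in H}], a [sigma]-stable subgroup with [z].  If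
    some element of [V] has its first coordinate outside [GF(2)], the Frobenius
    conjugates of that coordinate and the squares of elements of [V] force
    [V = U]; otherwise either a second coordinate is outside [GF(2)] and
    [V = GF(2) * F], or [V = GF(2) * GF(2)].  Hence [V] has order 4, 16 or 64
    ([card_sigma_stable]).  An element of [H] in [N] but not in [U] moves [z] so
    that [V = U], and then [H = G].  Every such [H] thus has order 12, 48, 192 or
    1344 ([order_above]), which bounds chains by three strict steps; and
    [N_G(P) < (GF(2) * F) P < U P < G] reaches this bound ([l_p_GG]). *)

(** * Centralisers and cosets *)

(** The coset [H :* x] is stable under conjugation by [H], and the orbit of [x]
    already has as many elements as the coset when nothing in [H] centralises
    [x]. *)
Lemma class_rcoset_cent1 (gT : finGroupType) (H : {group gT}) x :
  x \in 'N(H) -> 'C_H[x] = 1 -> x ^: H = H :* x.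
Proof.
move=> nHx cHx; apply/eqP; rewrite eqEcard card_rcoset -index_cent1 cHx indexg1.
rewrite leqnn andbT; apply/subsetP=> _ /imsetP[y Hy ->].
have -> : x ^ y = (y^-1 * y ^ x^-1) * x by rewrite !conjgE invgK !mulgA mulgKV.
by rewrite mem_rcoset mulgK groupM ?groupV ?memJ_norm ?groupV.
Qed.

(** * Chains of subgroups *)

Lemma chain_length_ge (gT : finGroupType) (H G : {group gT}) c :
  strict_chain H G c -> size c <= chain_length H G.
Proof.
move=> cP; have lt_c : size c < #|G|.+1 by rewrite ltnS ltnW ?(strict_chain_size cP).
apply: (leq_bigmax_cond (Ordinal lt_c)); apply/existsP.
by exists (in_tuple c).
Qed.

Lemma strict_chain_between (gT : finGroupType) (H G : {group gT}) c :
  strict_chain H G c ->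
  {in H :: c, forall A : {group gT}, (H \subset A) && (A \subset G)}.
Proof.
case/andP=> + /eqP <-; elim: c H => [|B c IHc] H /= => [_|/andP[ltHB cP]] A.
  by rewrite inE => /eqP->; rewrite subxx.
have sHB := proper_sub ltHB; rewrite inE => /predU1P[-> | cA].
  rewrite subxx (subset_trans sHB) //.
  by have /andP[] := IHc B cP B (mem_head _ _).
by have /andP[sBA ->] := IHc B cP A cA; rewrite (subset_trans sHB).
Qed.

(** Orders strictly increase along a chain, so a chain between two groups is no
    longer than the list of orders available between them. *)
Lemma chain_length_le_orders (gT : finGroupType) (H G : {group gT}) (s : seq nat) :
  (forall A : {group gT}, H \subset A -> A \subset G -> #|A| \in s) ->
  chain_length H G <= (size s).-1.
Proof.
move=> sP; apply/bigmax_leqP=> m /existsP[c cP].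
have sub_s : {subset map (fun A : {group gT} => #|A|) (H :: c) <= s}.
  by move=> _ /mapP[A /(strict_chain_between cP)/andP[sHA sAG] ->]; apply: sP.
have uc : uniq (map (fun A : {group gT} => #|A|) (H :: c)).
  apply: (sorted_uniq ltn_trans ltnn); rewrite /= path_map.
  by case/andP: cP => + _; apply: sub_path => A B; apply: proper_card.
have := uniq_leq_size uc sub_s; rewrite /= size_map size_tuple.
by case: (size s).
Qed.

(** * Degrees of irreducible characters *)

Section Degrees.
Variable gT : finGroupType.
Implicit Types G H N U : {group gT}.
Definition deg G (i : Iirr G) : nat := irr_degree (socle_of_Iirr i).

Lemma degE G (i : Iirr G) : ('chi_i 1%g = (deg i)%:R)%R.
Proof. exact: irr1_degree. Qed.

Lemma sum_sqr_deg G : \sum_(i : Iirr G) deg i ^ 2 = #|G|.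
Proof.
apply/eqP; rewrite -(eqr_nat algC) -irr_sum_square natr_sum.
by under [X in _ == X]eq_bigr => i _ do rewrite degE -natrX.
Qed.

Lemma sum_sqr_deg_quo G H : H <| G ->
  \sum_(i : Iirr G | H \subset cfker ('chi_i)%R) deg i ^ 2 = #|G : H|.
Proof.
move=> nsHG; rewrite -card_quotient ?normal_norm //.
apply/eqP; rewrite -(eqr_nat algC) -irr_sum_square natr_sum; apply/eqP.
have := sum_norm_irr_quo (group1 G) nsHG; rewrite morph1.
rewrite (eq_bigr (fun i => 'chi_i 1%g ^+ 2)%R) => [|i _]; last by rewrite irr1_degree normr_nat.
by move->; apply: eq_bigr => i _; rewrite degE normr_nat natrX.
Qed.

Lemma deg_dvdG G (i : Iirr G) : deg i %| #|G|.
Proof. by have := dvd_irr1_cardG i; rewrite degE dvdC_nat. Qed.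

Lemma deg_eq1 G (i : Iirr G) : (deg i == 1%N) = (G^`(1) \subset cfker ('chi_i)%R).
Proof. by rewrite -lin_irr_der1 qualifE/= irr_char degE pnatr_eq1. Qed.

Lemma deg_dvd_quo G H (i : Iirr G) : H <| G -> H \subset cfker ('chi_i)%R ->
  deg i %| #|G : H|.
Proof.
move=> nsHG kerH; have := dvd_irr1_index_center i; rewrite degE dvdC_nat => dvd_i.
apply: dvdn_trans dvd_i _.
have sHZ : H \subset 'Z(('chi_i)%R)%CF.
  by apply: subset_trans kerH (normal_sub (cfker_center_normal _)).
by rewrite -(Lagrange_index (cfcenter_sub _) sHZ) dvdn_mulr.
Qed.

(** By Clifford's theorem the constituents of the restriction of an irreducible
    character to a normal subgroup are conjugate. *)
Lemma deg_Res_constt G N (i : Iirr G) (j k : Iirr N) : N <| G ->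
  j \in irr_constt ('Res[N] 'chi_i)%R -> k \in irr_constt ('Res[N] 'chi_i)%R ->
  deg j = deg k.
Proof.
move=> nsNG jRes kRes; apply/eqP; rewrite -(eqr_nat algC) -!degE.
have := kRes; rewrite irr_consttE (Clifford_Res_sum_cfclass nsNG jRes).
rewrite cfdotZl cfdot_suml.
have [/cfclassP[y _ ->]|notk] := boolP (('chi_k)%R \in (('chi_j)%R ^: G)%CF).
  by rewrite cfConjg1.
rewrite big1_seq ?mulr0 ?eqxx // => _ /andP[_ /[dup] /cfclassP[y _ ->] chi_in].
rewrite -conjg_IirrE cfdot_irr; case: eqP => // kE; case/negP: notk.
by rewrite -kE conjg_IirrE.
Qed.

(** If [U] acts trivially through ['chi_j], then the trivial character of [U] is a
    constituent of the restriction of ['chi_i], and the vectors fixed by the normal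
    subgroup [U] form a nonzero submodule. *)
Lemma sub_cfker_Res_constt G N U (i : Iirr G) (j : Iirr N) :
  U <| G -> N <| G -> U \subset N -> j \in irr_constt ('Res[N] 'chi_i)%R ->
  U \subset cfker ('chi_j)%R -> U \subset cfker ('chi_i)%R.
Proof.
move=> nsUG nsNG sUN jRes kerU; apply: (constt0_Res_cfker nsUG).
rewrite -(cfResRes _ sUN (normal_sub nsNG)).
apply: (constt_Res_trans _ jRes); first by rewrite cfRes_char ?irr_char.
rewrite irr_consttE irr0 cfRes_sub_ker //.
by rewrite cfdotZl cfnorm1 mulr1 irr1_neq0.
Qed.

(** * Counting the characters of degree divisible by 3 *)

Section Count.
Variables (G N U : {group gT}).
Hypotheses (nsUG : U <| G) (sUN : U \subset N) (cardG : #|G| = 1344)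
  (cardN : #|N| = 448) (cardU : #|U| = 64) (der1G : G^`(1) = N)
  (classN : #|classes N| <= 10).

Let nsNG : N <| G.
Proof. have := der_normal 1 G; by rewrite der1G. Qed.
Let nsUN : U <| N.
Proof. exact: normalS sUN (normal_sub nsNG) nsUG. Qed.

(** The quotient [N / U] has prime order 7, so the irreducible characters of [N]
    with [U] in the kernel are the seven linear characters of [N / U]; this leaves
    three of the at most ten. *)
Lemma card_nonker_irr : #|[set j : Iirr N | ~~ (U \subset cfker ('chi_j)%R)]| <= 3.
Proof.
have -> : [set j : Iirr N | ~~ (U \subset cfker ('chi_j)%R)] =
          ~: [set j : Iirr N | U \subset cfker ('chi_j)%R].
  by apply/setP=> j; rewrite !inE.
have idxNU : #|N : U| = 7 by rewrite -divgS // cardN cardU.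
have sN'U : N^`(1) \subset U.
  rewrite der1_min ?normal_norm // cyclic_abelian ?prime_cyclic //.
  by rewrite card_quotient ?normal_norm // idxNU.
have kerN : #|[set j : Iirr N | U \subset cfker ('chi_j)%R]| = 7.
  rewrite -idxNU -(sum_sqr_deg_quo nsUN) -sum1dep_card.
  apply: eq_bigr => j kerU; suff /eqP-> : deg j == 1%N by [].
  by rewrite deg_eq1 (subset_trans sN'U).
by rewrite -(leq_add2l 7) -{1}kerN cardsC card_ord NirrE.
Qed.

(** Degree divisible by 3 makes the restriction to [N] reducible, because 3 does
    not divide [#|N|].  The three constituents would have the same degree and,
    were [U] not in the kernel, would be all the characters that
    [card_nonker_irr] counts; but 441 is not three times a square. *)
Lemma dvd3_deg_ker (i : Iirr G) : 3 %| deg i -> U \subset cfker ('chi_i)%R.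
Proof.
move=> dvd3; apply: contraTT isT => nkerU.
have idxGN : #|G : N| = 3 by rewrite -divgS ?normal_sub // cardG cardN.
have sNG := normal_sub nsNG.
case: (cfRes_prime_irr_cases i nsNG idxGN isT) => [/irrP[j ResE] | [c injc ResE]].
  have := deg_dvdG j; have -> : deg j = deg i.
    by apply/eqP; rewrite -(eqr_nat algC) -!degE -ResE cfRes1.
  by move/(dvdn_trans dvd3); rewrite cardN.
have cRes k : c k \in irr_constt ('Res[N] 'chi_i)%R.
  rewrite irr_consttE ResE cfdot_suml (bigD1 k) //= cfdot_irr eqxx big1 => [|l lk].
    by rewrite addr0 oner_eq0.
  by rewrite cfdot_irr (inj_eq injc) (negPf lk).
have imc : c @: 'I_3 = [set j : Iirr N | ~~ (U \subset cfker ('chi_j)%R)].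
  apply/eqP; rewrite eqEcard card_imset ?card_ord ?card_nonker_irr // andbT.
  apply/subsetP=> _ /imsetP[k _ ->]; rewrite inE.
  by apply: contra nkerU; apply: sub_cfker_Res_constt (cRes k).
have := sum_sqr_deg N; rewrite (bigID (fun j : Iirr N => U \subset cfker ('chi_j)%R)) /=.
rewrite sum_sqr_deg_quo // -divgS // cardN cardU.
rewrite -(eq_bigl _ _ (fun j => in_set _ j)) -imc big_imset /=; last exact: in2W injc.
rewrite (eq_bigr (fun=> deg (c ord0) ^ 2)%N) => [|k _]; last first.
  by rewrite (deg_Res_constt nsNG (cRes k) (cRes ord0)).
rewrite sum_nat_const card_ord; set d := deg _ => dE.
(* [3 * 12 ^ 2 < 441 < 3 * 13 ^ 2] *)
have [d_le | d_gt] := leqP d 12.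
  by do 13?[case: d dE d_le => [|d] dE d_le //].
have := leq_mul (leqnn 3) (leq_mul d_gt d_gt).
by rewrite -(leq_add2l 7) [(d * d)%N]mulnn [(7 + 3 * d ^ 2)%N]dE.
Qed.

(** On the characters of [G / U], of order 21, a degree is 1 or 3 as it divides
    21 and its square is at most 21. The linear ones contribute
    [#|G : N| = 3] to the sum of squares, and the others [21 - 3 = 2 * 9]. *)
Lemma card_Irr_3 : #|Irr_p 3 G| = 2.
Proof.
have sNG := normal_sub nsNG.
have idxGU : #|G : U| = 21 by rewrite -divgS ?normal_sub // cardG cardU.
have deg_quo3 (i : Iirr G) : U \subset cfker ('chi_i)%R -> deg i = 1%N \/ deg i = 3.
  move=> kerU; have := deg_dvd_quo nsUG kerU; rewrite idxGU.
  have : deg i ^ 2 <= 21.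
    by rewrite -idxGU -(sum_sqr_deg_quo nsUG) (bigD1 i) //= leq_addr.
  case: (deg i) => [|[|[|[|[|n]]]]] //; try by [left | right].
  by rewrite leqNgt (@leq_trans (5 ^ 2)) // leq_sqr.
have defIrr : Irr_p 3 G =
    [set i : Iirr G | (U \subset cfker ('chi_i)%R) && ~~ (N \subset cfker ('chi_i)%R)].
  apply/setP=> i; rewrite !inE degE dvdC_nat -der1G -deg_eq1.
  apply/idP/andP=> [dvd3 | [kerU]].
    by split; [exact: dvd3_deg_ker | apply: contraL dvd3 => /eqP->].
  by case/deg_quo3: kerU => ->.
have := sum_sqr_deg_quo nsUG; rewrite idxGU.
rewrite (bigID (fun i : Iirr G => N \subset cfker ('chi_i)%R)) /=.
rewrite (eq_bigl (fun i : Iirr G => N \subset cfker ('chi_i)%R)) => [|i]; last first.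
  by rewrite andb_idl // => kerN; apply: subset_trans kerN.
rewrite sum_sqr_deg_quo // -divgS // cardG cardN.
rewrite -(eq_bigl _ _ (fun j => in_set _ j)) -defIrr.
rewrite (eq_bigr (fun=> 9)) => [|i]; last first.
  rewrite defIrr inE => /andP[kerU]; rewrite -der1G -deg_eq1.
  by case/deg_quo3: kerU => ->.
rewrite sum_nat_const; case: #|_| => [|[|[|n]]] //.
Qed.
End Count.
End Degrees.

(** * Arithmetic in the field with eight elements *)

Section Structure.
Variables (F : finFieldType) (cardF : #|F| = 8) (t : {unit F}).
Hypothesis gen_t : generator [set: {unit F}] t.
Local Notation U := (Defs.U cardF).
Local Notation gT := (sdprod_by (K_action cardF t)).

Section Field.
Local Open Scope ring_scope.
Lemma expF8 (x : F) : x ^+ 8 = x.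
Proof. by rewrite -{1}cardF expf_card. Qed.

Lemma addFF (x : F) : x + x = 0.
Proof. exact: (addrr_pchar2 (pchar2 cardF)). Qed.

Lemma sqrF_id (x : F) : (x ^+ 2 == x) = (x == 0) || (x == 1).
Proof. by rewrite -subr_eq0 -{2}(mulr1 x) -mulrBr mulf_eq0 subr_eq0. Qed.

Lemma tauF_id (x : F) : (x ^+ 4 == x) = (x ^+ 2 == x).
Proof.
apply/eqP/eqP=> xE; last by rewrite (exprM x 2 2) !xE.
by rewrite -{1}xE -exprM expF8.
Qed.

(** In a group of order 7, [5 * 3 = 1] as exponents. *)
Lemma exp5FK : cancel (fun x : F => x ^+ 5) (fun x => x ^+ 3).
Proof.
by move=> x; rewrite -exprM -[(5 * 3)%N]/(8 + 7)%N exprD expF8 -exprS expF8.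
Qed.

Lemma exp3FK : cancel (fun x : F => x ^+ 3) (fun x => x ^+ 5).
Proof. by move=> x; rewrite -exprM mulnC exprM exp5FK. Qed.

(** The trace of [b] to [GF(2)] is 0 or 1.  As [b ^ 16 = b ^ 2], the witness
    [b ^ 4] gives [b ^ 2 + b ^ 4], which is [b] plus its trace. *)
Lemma tau_add_surj (b : F) : exists c : F, b = c ^+ 4 + c \/ b = c ^+ 4 + c + 1.
Proof.
exists (b ^+ 4); rewrite -exprM -[(4 * 4)%N]/(8 + 8)%N exprD expF8 -expr2.
have: (b + b ^+ 2 + b ^+ 4) ^+ 2 == b + b ^+ 2 + b ^+ 4.
  by rewrite !(sqrD cardF) -!exprM expF8 addrC addrA.
rewrite -addrA sqrF_id => /orP[] /eqP bE; [left | right].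
  by move/eqP: bE; rewrite addr_eq0 (oppr_pchar2 (pchar2 cardF)) => /eqP.
by rewrite -bE addrC addrA addFF add0r.
Qed.
End Field.

(** * Elements of the semidirect product *)

Local Notation e := (@sdpair1 _ _ _ _ (K_action cardF t) : U -> gT).
Local Notation i2 := (@sdpair2 _ _ _ _ (K_action cardF t)).
Local Notation f := (fun s => i2 (phi cardF s)).
Local Notation g := (i2 (sigma cardF)).

(** The constructor fixes the type of pairs to [U], so that the product of two of
    them is the group law and not the componentwise one. *)
Definition mkU (a b : F) : U := (a, b).

Lemma mulUE (a b c d : F) : mkU a b * mkU c d = mkU (a + c)%R (b + d + a ^+ 4 * c)%R.
Proof. by []. Qed.

Lemma phiM : {morph phi cardF : s r / s * r}.
Proof.
move=> s r; apply/permP=> -[a b]; rewrite permM !permE /phi_fun /=.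
by rewrite [(val s * val r)%R]mulrC exprMn !mulrA.
Qed.

Lemma phi1 : phi cardF 1 = 1.
Proof. by apply/permP=> -[a b]; rewrite permE perm1 /phi_fun /= expr1n !mul1r. Qed.

Lemma phiX s n : phi cardF (s ^+ n) = phi cardF s ^+ n.
Proof. by elim: n => [|n IHn]; rewrite ?phi1 // !expgS phiM IHn. Qed.

Lemma phi_in_K s : phi cardF s \in K cardF t.
Proof.
have: s \in <[t]> by rewrite -(eqP gen_t) inE.
by case/cycleP=> n ->; rewrite phiX mem_gen // inE groupX ?cycle_id.
Qed.

Lemma sigma_in_K : sigma cardF \in K cardF t.
Proof. by rewrite mem_gen // inE cycle_id orbT. Qed.

Lemma actJ (x : U) k : k \in K cardF t -> e x ^ i2 k = e (k x).
Proof.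
by move=> Kk; rewrite -sdpair_act ?inE.
Qed.

Lemma eJf a b s : e (mkU a b) ^ f s = e (mkU (val s * a)%R (val s ^+ 5 * b)%R).
Proof. by rewrite actJ ?phi_in_K // permE. Qed.

Lemma eJg a b : e (mkU a b) ^ g = e (mkU (a ^+ 2)%R (b ^+ 2)%R).
Proof. by rewrite actJ ?sigma_in_K // permE. Qed.

Lemma phiJsigma s : phi cardF s ^ sigma cardF = phi cardF (s ^+ 2).
Proof.
apply: (mulgI (sigma cardF)); rewrite -conjgC; apply/permP=> -[a b].
rewrite !permM !permE /sigma_fun /phi_fun FinRing.val_unitX /=.
by congr (_, _); rewrite exprMn // exprAC.
Qed.

(** * Orders and normal subgroups *)

Local Notation UU := (e @* [set: U])%G.
Local Notation TT := (i2 @* T cardF t)%G.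
Local Notation PP := (PG cardF t).

Lemma phi_injective : injective (phi cardF).
Proof.
move=> s r /permP/(_ (mkU 1%R 0%R)); rewrite !permE /phi_fun /= !mulr1 => -[eq_sr *].
exact: val_inj.
Qed.

Lemma card_unitF : #|[set: {unit F}]| = 7.
Proof. by rewrite card_finField_unit cardF. Qed.

Lemma unitF_X7 (s : {unit F}) : s ^+ 7 = 1.
Proof. by apply/eqP; rewrite -order_dvdn -card_unitF order_dvdG ?inE. Qed.

Lemma t_neq1 : t != 1.
Proof.
apply: contraTneq gen_t => ->; apply/eqP=> /(congr1 (fun A : {set _} => #|A|)).
by rewrite card_unitF cycle1 cards1.
Qed.

Lemma card_T : #|T cardF t| = 7.
Proof.
apply: nt_prime_order => //; first by rewrite -phiX unitF_X7 phi1.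
by rewrite -phi1 (inj_eq phi_injective) t_neq1.
Qed.

Lemma card_P : #|P cardF| = 3.
Proof.
apply: nt_prime_order => //.
  apply/permP=> -[a b]; rewrite !permM perm1 !permE /sigma_fun /= -!exprM.
  by rewrite !expF8.
apply/eqP=> /permP/(_ (mkU (val t) 0%R)); rewrite permE perm1 => -[/eqP].
rewrite sqrF_id => /orP[/eqP t0 _ | /eqP t1 _]; last by case/eqP: t_neq1; apply: val_inj.
by have := valP t; rewrite /= t0 unitr0.
Qed.

Lemma sdprod_TP : T cardF t ><| P cardF = K cardF t.
Proof.
have nTP : P cardF \subset 'N(T cardF t).
  rewrite cycle_subG -cycle_subG cycle_subG inE -cycleJ cycle_subG.
  by rewrite phiJsigma phiX mem_cycle.
rewrite sdprodE ?coprime_TIg ?card_T ?card_P //.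
by rewrite -norm_joinEr.
Qed.

Lemma sdprod_UU_K : UU ><| (i2 @* K cardF t) = [set: gT].
Proof. exact: sdprod_sdpair. Qed.

Lemma card_UU : #|UU| = 64.
Proof. by rewrite card_injm ?injm_sdpair1 // cardsT card_prod cardF. Qed.

Lemma card_GG : #|[set: gT]| = 1344.
Proof.
rewrite -(sdprod_card sdprod_UU_K) card_UU card_injm ?injm_sdpair2 //.
by rewrite -(sdprod_card sdprod_TP) card_T card_P.
Qed.

Lemma card_TT : #|TT| = 7.
Proof. by rewrite card_injm ?injm_sdpair2 ?card_T // joing_subl. Qed.

Lemma card_PP : #|PP| = 3.
Proof. by rewrite card_injm ?injm_sdpair2 ?card_P // joing_subr. Qed.

Lemma GG_norm_UU : [set: gT] \subset 'N(UU).
Proof. by have [/andP[]] := sdprod_context sdprod_UU_K. Qed.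

Lemma TI_UU_TT : UU :&: TT = 1.
Proof. by rewrite coprime_TIg // card_UU card_TT. Qed.

Definition NN := (UU <*> TT)%G.

Lemma defNN : NN = UU * TT :> {set gT}.
Proof. by rewrite /= norm_joinEr // (subset_trans (subsetT _) GG_norm_UU). Qed.

Lemma card_NN : #|NN| = 448.
Proof. by rewrite defNN TI_cardMg ?TI_UU_TT // card_UU card_TT. Qed.

Lemma NN_normal : NN <| [set: gT].
Proof.
rewrite /normal subsetT /= -(sdprodW sdprod_UU_K) mul_subG //.
  exact: subset_trans (joing_subl _ _) (normG NN).
have -> : i2 @* K cardF t = TT * PP.
  by rewrite -morphimMl ?joing_subl ?(sdprodW sdprod_TP).
rewrite mul_subG //.
  exact: subset_trans (joing_subr _ _) (normG NN).
rewrite normsY ?(subset_trans (subsetT _) GG_norm_UU) //.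
by rewrite morphim_norms //; have [] := sdprodP sdprod_TP.
Qed.

Lemma TI_NN_PP : NN :&: PP = 1.
Proof. by rewrite coprime_TIg // card_NN card_PP. Qed.

Lemma defGG : NN * PP = [set: gT].
Proof.
by apply/eqP; rewrite eqEcard subsetT TI_cardMg ?TI_NN_PP // card_NN card_PP card_GG.
Qed.

(** * Conjugacy classes of [N] and the derived subgroup *)

Lemma TT_f n : n \in TT -> exists s, n = f s.
Proof. by case/morphimP=> k _ /cycleP[m ->] ->; exists (t ^+ m); rewrite phiX. Qed.

Lemma f_TT s : f s \in TT.
Proof.
have: s \in <[t]> by rewrite -(eqP gen_t) inE.
by case/cycleP=> m ->; rewrite phiX mem_morphim ?mem_cycle // -phiX phi_in_K.
Qed.

Lemma NN_ef n : n \in NN -> exists x s, n = e x * f s.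
Proof.
rewrite defNN => /mulsgP[_ k /morphimP[x _ _ ->] /TT_f[s ->] ->].
by exists x, s.
Qed.

Lemma e_UU x : e x \in UU. Proof. by rewrite mem_morphim ?inE. Qed.

Lemma e_NN x : e x \in NN. Proof. by rewrite mem_gen // inE e_UU. Qed.

Lemma f_NN s : f s \in NN. Proof. by rewrite mem_gen // inE f_TT orbT. Qed.

Lemma eM x y : e x * e y = e (x * y).
Proof. by rewrite morphM ?inE. Qed.

Lemma e_inj : injective e.
Proof. by move=> x y; apply: (injmP (injm_sdpair1 _)); rewrite ?inE. Qed.

Lemma f_inj : injective f.
Proof.
move=> s r /= /(injmP (injm_sdpair2 _)) eq_sr.
by apply: phi_injective; rewrite eq_sr ?phi_in_K.
Qed.

Lemma unit_mul_fix (s : {unit F}) (a : F) : (val s * a = a)%R -> s != 1 -> a = 0%R.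
Proof.
move=> sa; apply: contraNeq => a0; apply/eqP/val_inj.
by apply: (mulIf a0); rewrite mul1r.
Qed.

Lemma unitF_X5 (s : {unit F}) : s != 1 -> s ^+ 5 != 1.
Proof.
apply: contraNneq => s5; apply/eqP/val_inj.
by rewrite -[LHS]exp5FK -FinRing.val_unitX s5 /= expr1n.
Qed.

Lemma cent_f s : s != 1 -> 'C_UU[f s] = 1.
Proof.
move=> s1; apply/trivgP/subsetP=> _ /setIP[/morphimP[[a b] _ _ ->] /cent1P].
move/commgP/conjg_fixP; rewrite eJf => /e_inj[sa sb].
have a0 := unit_mul_fix sa s1.
have b0 : b = 0%R.
  by apply: (@unit_mul_fix (s ^+ 5)) (unitF_X5 s1); rewrite FinRing.val_unitX.
by rewrite inE a0 b0 morph1.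
Qed.

Lemma class_f s : s != 1 -> f s ^: UU = UU :* f s.
Proof.
by move/cent_f; apply: class_rcoset_cent1; rewrite (subsetP GG_norm_UU) ?inE.
Qed.

(** [f t] is the commutator of [f t] with [g], as [g] conjugates [f t] to its
    square; and [e x * f t] is conjugate to [f t], so [e x] is a product of
    elements of the derived subgroup. *)
Lemma der1_GG : [set: gT]^`(1) = NN.
Proof.
apply/eqP; rewrite eqEsubset der1_min ?normal_norm ?NN_normal //=; last first.
  rewrite cyclic_abelian // prime_cyclic // card_quotient ?normal_norm ?NN_normal //.
  by rewrite -divgS ?subsetT // card_GG card_NN.
have fG' : f t \in [set: gT]^`(1).
  have -> : f t = [~ f t, g].
    rewrite commgEl -morphJ ?phi_in_K ?sigma_in_K // phiJsigma phiX.
    by rewrite morphX ?phi_in_K // expgS mulKg.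
  by rewrite mem_commg ?inE.
rewrite join_subG; apply/andP; split; last first.
  by rewrite morphim_cycle ?phi_in_K // cycle_subG.
apply/subsetP=> _ /morphimP[x _ _ ->].
have : e x * f t \in UU :* f t by rewrite mem_rcoset mulgK e_UU.
rewrite -class_f ?t_neq1 // => /imsetP[y _ def_y].
by rewrite -(groupMr _ fG') def_y conjg_mulR groupM // mem_commg ?inE.
Qed.

Definition reps : {set gT} :=
  [set x in [:: e 1; e (mkU 0%R 1%R); e (mkU 1%R 0%R); e (mkU 1%R 1%R)]]
    :|: [set f s | s in [set~ 1]].

Lemma neq0_unit (a : F) : a != 0%R -> exists s : {unit F}, val s = a.
Proof.
by rewrite -unitfE => ua; exists (FinRing.unit F ua).
Qed.

(** Outside [U] this is [class_f].  In [U], an element [(0, b)] with [b != 0] is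
    conjugate under [T] to [(0, 1)] because fifth powers exhaust the field; an
    element [(a, b)] with [a != 0] is first conjugated under [T] to some
    [(1, d)], whose second coordinate can be changed by any [c ^ 4 + c]. *)
Lemma NN_reps n : n \in NN -> exists2 x, x \in reps & n \in x ^: NN.
Proof.
case/NN_ef=> [[a b] [s ->]].
have [->|s1] := eqVneq s 1; last first.
  exists (f s); first by apply/setUP; right; apply/imsetP; exists s; rewrite ?inE.
  apply: (subsetP (imsetS _ (joing_subl UU TT))).
  by rewrite -/(f s ^: UU) class_f // mem_rcoset mulgK e_UU.
rewrite phi1 morph1 mulg1.
have [-> {a}|] := eqVneq a 0%R.
  have [->|] := eqVneq b 0%R.
    by exists (e 1); rewrite ?class_refl // /reps !inE eqxx.
  case/neq0_unit=> {}s <-; exists (e (mkU 0%R 1%R)); first by rewrite /reps !inE eqxx !orbT.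
  apply/imsetP; exists (f (s ^+ 3)); first exact: f_NN.
  by rewrite eJf mulr0 mulr1 FinRing.val_unitX exp3FK.
case/neq0_unit=> {}s <-.
(* Normalising the first coordinate to 1 divides the second by [s ^ 5]. *)
suff [x xr xc] : exists2 x, x \in reps & e (mkU 1%R (b / val s ^+ 5)%R) \in x ^: NN.
  exists x => //; have -> : e (mkU (val s) b) = e (mkU 1%R (b / val s ^+ 5)%R) ^ f s.
    by rewrite eJf mulr1 mulrC divrK // unitrX // (valP s).
  by rewrite -(class_eqP xc) memJ_class ?f_NN.
have cJ c d : e (mkU 1%R d) ^ e (mkU c 0%R) = e (mkU 1%R (c ^+ 4 + c + d)%R).
  apply: (mulgI (e (mkU c 0%R))); rewrite -conjgC !eM; congr (e _).
  rewrite !mulUE expr1n mul1r mulr1 addr0 add0r; congr mkU; first exact: addrC.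
  by rewrite [RHS]addrC !addrA addFF add0r addrC.
have [c [->|->]] := tau_add_surj (b / val s ^+ 5)%R.
  exists (e (mkU 1%R 0%R)); first by rewrite /reps !inE eqxx !orbT.
  by apply/imsetP; exists (e (mkU c 0%R)); rewrite ?e_NN // cJ addr0.
exists (e (mkU 1%R 1%R)); first by rewrite /reps !inE eqxx !orbT.
by apply/imsetP; exists (e (mkU c 0%R)); rewrite ?e_NN // cJ.
Qed.

Lemma card_classes_NN : #|classes NN| <= 10.
Proof.
have le_reps : #|reps| <= 10.
  apply: leq_trans (leq_card_setU _ _) _; rewrite cardsE (leq_add (n1 := 4)) ?card_size //.
  by rewrite (leq_trans (leq_imset_card _ _)) // cardsC1 -cardsT card_unitF.
apply: leq_trans (leq_trans (subset_leq_card _) (leq_imset_card (fun x => x ^: NN) reps)) le_reps.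
apply/subsetP=> _ /imsetP[n /NN_reps[x xr xc] ->].
by apply/imsetP; exists x; rewrite ?(class_eqP xc).
Qed.

(** * The Sylow subgroup and the characters of degree divisible by 3 *)

Lemma Sylow_PP : 3.-Sylow([set: gT]) PP.
Proof.
rewrite /pHall subsetT -divgS ?subsetT // card_PP card_GG p'natE //.
by rewrite /pgroup card_PP pnat_id.
Qed.

Lemma card_Irr_3_GG : #|Irr_p 3 (G cardF t)| = 2.
Proof.
apply: (@card_Irr_3 _ _ NN UU); rewrite ?card_GG ?card_NN ?card_UU //.
- by rewrite /normal subsetT GG_norm_UU.
- exact: joing_subl.
- exact: der1_GG.
- exact: card_classes_NN.
Qed.

(** * Subgroups of [U] stable under the Frobenius map *)

Section StableSubgroups.

Local Open Scope ring_scope.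

Lemma sqrF_inj (x y : F) : x ^+ 2 = y ^+ 2 -> x = y.
Proof. by move=> xy; rewrite -[x]expF8 -[y]expF8 !(exprM _ 2 4) xy. Qed.

(** More than half of the field: the subgroups below are shown to be full by
    finding these five elements in them. *)
Lemma Frobenius_uniq (a : F) : a ^+ 2 != a -> uniq [:: 0; 1; a; a ^+ 2; a ^+ 4].
Proof.
move=> /[dup] a2; rewrite sqrF_id negb_or => /andP[a0 a1] /=.
rewrite !inE !negb_or !(eq_sym 0) oner_eq0 !expf_neq0 // a0 /= !(eq_sym 1) a1.
rewrite (eq_sym a (_ ^+ 2)) a2 (eq_sym a) tauF_id a2 /= andbT -andbA; apply/and3P; split.
- by apply: contraNneq a1 => a1; rewrite -[a]expF8 (exprM _ 2 4) a1 expr1n.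
- by apply: contraNneq a1 => a1; rewrite -[a]expF8 (exprM _ 4 2) a1 expr1n.
- by rewrite (exprM a 2 2); apply: contraNneq a2 => /sqrF_inj {2}->.
Qed.

(** The centre of [U]. *)
Definition ZU : {set U} := [set mkU 0 c | c : F].

Lemma mem_ZU c : mkU 0 c \in ZU.
Proof. exact: imset_f. Qed.

Lemma ZU_group_set : group_set ZU.
Proof.
apply/group_setP; split; first by apply/imsetP; exists 0.
move=> _ _ /imsetP[c _ ->] /imsetP[d _ ->]; rewrite mulUE mulr0 !addr0.
exact: imset_f.
Qed.

Canonical ZU_group := group ZU_group_set.

Lemma card_ZU : #|ZU| = 8.
Proof. by rewrite card_imset ?cardF // => c d []. Qed.

Variable V : {group U}.
Hypotheses (sigmaV : forall x : U, x \in V -> sigma_fun x \in V)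
  (zV : mkU 1 0 \in V).

Lemma z2V : mkU 0 1 \in V.
Proof.
by have := groupM zV zV; rewrite mulUE addFF !add0r expr1n mulr1.
Qed.

Lemma z3V : mkU 1 1 \in V.
Proof.
by have := groupM zV z2V; rewrite mulUE mulr0 add0r !addr0.
Qed.

(** Five second coordinates occur in [V], by stability, and 5 is too many for a
    proper subgroup of a group of order 8. *)
Lemma ZU_sub_stable b : mkU 0 b \in V -> b ^+ 2 != b -> ZU \subset V.
Proof.
move=> Vb b2; have sig c : mkU 0 c \in V -> mkU 0 (c ^+ 2) \in V.
  by move/sigmaV; rewrite /sigma_fun /= expr0n.
have: (5 <= #|V :&: ZU|)%N.
  rewrite -[5%N]/(size [:: 0; 1; b; b ^+ 2; b ^+ 4]) -(card_uniqP (Frobenius_uniq b2)).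
  rewrite -(@card_imset _ _ (mkU 0)); last by move=> c d [].
  apply/subset_leq_card/subsetP=> _ /imsetP[c + ->] => cP; apply/setIP; split; last exact: mem_ZU.
  move: cP.
  rewrite !inE => /or4P[/eqP->|/eqP->|/eqP->|/pred2P[]->] //; rewrite ?z2V //.
  - exact: (group1 V).
  - exact: sig.
  - by rewrite (exprM b 2 2) !sig.
have := cardSg (subsetIr V ZU); rewrite card_ZU => /dvdnP[k].
case: k => [|[|k]]; first by rewrite mul0n.
  rewrite mul1n => cVZ _.
  by apply/setIidPr/eqP; rewrite eqEcard subsetIr card_ZU -cVZ.
move=> cE c5; have := leq_mul (isT : 2 <= k.+2)%N c5.
by rewrite -cE.
Qed.

(** The square of [(a, b)] is [(0, a ^ 5)] with [a ^ 5] outside [GF(2)], so [V]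
    contains the centre; with it, [V] contains the full fibres over the five
    first coordinates 0, 1, [a], [a ^ 2], [a ^ 4], and 40 exceeds half of 64. *)
Lemma sigma_stable_full a b : mkU a b \in V -> a ^+ 2 != a -> V = [set: U]%G.
Proof.
move=> Vab a2; have sZV : ZU \subset V.
  apply: (@ZU_sub_stable (a ^+ 5)).
    by have := groupM Vab Vab; rewrite mulUE !addFF add0r -exprSr.
  apply: contraNneq a2; rewrite -exprM mulnC exprM => a2.
  by rewrite -[_ ^+ 2]exp5FK a2 exp5FK.
have fiber x d c : mkU x d \in V -> mkU x c \in V.
  move=> Vxd; have -> : mkU x c = (mkU x d * mkU 0%R (c - d)%R)%g.
    by rewrite mulUE mulr0 !addr0 addrC subrK.
  by rewrite groupM // (subsetP sZV) ?mem_ZU.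
have sig x c : mkU x c \in V -> mkU (x ^+ 2) (c ^+ 2) \in V by move/sigmaV.
have: (40 <= #|V|)%N.
  pose S := [set x in [:: 0; 1; a; a ^+ 2; a ^+ 4]].
  have cardS : #|S| = 5%N by rewrite cardsE (card_uniqP (Frobenius_uniq a2)).
  have -> : 40%N = #|setX S [set: F]| by rewrite cardsX cardS cardsT cardF.
  apply/subset_leq_card/subsetP=> -[x d] /setXP[+ _]; rewrite inE => xP.
  suff [c Vxc] : exists c, mkU x c \in V by apply: fiber Vxc.
  move: xP; rewrite !inE => /or4P[/eqP->|/eqP->|/eqP->|/pred2P[]->].
  - by exists 0; apply: (group1 V).
  - by exists 0.
  - by exists b.
  - by exists (b ^+ 2); apply: sig.
  - by exists (b ^+ 2 ^+ 2); rewrite (exprM a 2 2); apply: sig (sig a b Vab).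
have cardU : #|[set: U]%G| = 64%N by rewrite cardsT card_prod cardF.
have := cardSg (subsetT V); rewrite cardU => /dvdnP[[|[|k]] // kE c40].
  by apply/eqP; rewrite -val_eqE /= eqEcard subsetT cardU kE mul1n /=.
have := leq_mul (isT : 2 <= k.+2)%N c40.
by rewrite -kE.
Qed.

Let GF2 : {set F} := [set 0; 1].
Lemma GF2E x : (x \in GF2) = (x ^+ 2 == x).
Proof. by rewrite !inE sqrF_id. Qed.

(** By [sigma_stable_full] the first coordinates lie in [GF(2)] unless [V] is all of
    [U]; then [ZU_sub_stable] leaves two possibilities for the second ones. *)
Lemma card_sigma_stable : #|V| \in [:: 4; 16; 64]%N.
Proof.
have cardGF2 : #|GF2| = 2%N by rewrite cards2 eq_sym oner_eq0.
have [/existsP[[a b] /andP[Vab a2]] | noa] :=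
  boolP [exists x : U, (x \in V) && (x.1 ^+ 2 != x.1)].
  by rewrite (sigma_stable_full Vab a2) cardsT card_prod cardF.
have {}noa a b : mkU a b \in V -> a ^+ 2 == a.
  by move=> Vab; apply: contraNT noa => a2; apply/existsP; exists (mkU a b); rewrite Vab.
(* Multiplying by [(1, 0)] clears the first coordinate, and adds 1 to the second:
   this does not change whether the latter is in [GF(2)]. *)
have to0 a b : mkU a b \in V -> mkU 0 b \in V \/ mkU 0 (b + 1) \in V.
  move=> Vab; have := noa _ _ Vab; rewrite sqrF_id => /orP[] /eqP a0.
    by left; rewrite -a0.
  by right; have := groupM Vab zV; rewrite a0 mulUE addFF addr0 expr1n mulr1.
have [/existsP[[a b] /andP[Vab b2]] | nob] :=
  boolP [exists x : U, (x \in V) && (x.2 ^+ 2 != x.2)].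
  have sZV : ZU \subset V.
    have [V0b|V0b] := to0 _ _ Vab; first exact: ZU_sub_stable V0b b2.
    apply: ZU_sub_stable V0b _; rewrite (sqrD cardF) expr1n.
    by apply: contraNneq b2 => /addIr /eqP.
  have -> : V = setX GF2 setT :> {set U}.
    apply/setP=> -[x c]; rewrite in_setX GF2E in_setT andbT.
    apply/idP/idP=> [/noa // |]; rewrite sqrF_id => /orP[] /eqP->.
      by rewrite (subsetP sZV) ?mem_ZU.
    have -> : (1, c) = (mkU 1%R 0%R * mkU 0%R c)%g by rewrite mulUE mulr0 !addr0 add0r.
    by rewrite groupM // (subsetP sZV) ?mem_ZU.
  by rewrite cardsX cardGF2 cardsT cardF.
have {}nob a b : mkU a b \in V -> b ^+ 2 == b.
  by move=> Vab; apply: contraNT nob => b2; apply/existsP; exists (mkU a b); rewrite Vab.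
have -> : V = setX GF2 GF2 :> {set U}.
  apply/setP=> -[x c]; rewrite in_setX !GF2E; apply/idP/andP=> [Vxc|[]].
    by rewrite (noa _ _ Vxc) (nob _ _ Vxc).
  rewrite !sqrF_id => /orP[] /eqP-> /orP[] /eqP->; rewrite ?z2V ?z3V //.
  exact: (group1 V).
by rewrite cardsX cardGF2.
Qed.

End StableSubgroups.

(** * Subgroups above the Sylow normaliser *)

Lemma ef_inj x y s r : e x * f s = e y * f r -> x = y /\ s = r.
Proof.
move=> eq_ef; have fE : f s * (f r)^-1 = (e x)^-1 * e y.
  by apply: (mulgI (e x)); rewrite mulgA eq_ef mulgK mulKVg.
have: f s * (f r)^-1 \in UU :&: TT.
  by rewrite inE {1}fE !groupM ?groupV ?e_UU ?f_TT.
rewrite TI_UU_TT => /set1P/eqP; rewrite -eq_mulgV1 => /eqP/f_inj sr; split=> //.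
by move: eq_ef; rewrite sr => /mulIg/e_inj.
Qed.

(** [sigma] squares the [T]-part, and [s ^ 2 = s] forces [s = 1]. *)
Lemma cent_NN n : n \in NN -> n ^ g = n -> exists2 x : U, sigma_fun x = x & n = e x.
Proof.
case/NN_ef=> [[a b] [s ->]].
rewrite conjMg eJg -morphJ ?phi_in_K ?sigma_in_K // phiJsigma => /ef_inj[xE sE].
exists (mkU a b); first exact: xE.
have -> : s = 1 by apply: (mulgI s); rewrite mulg1.
by rewrite phi1 morph1 mulg1.
Qed.

(** [H] is the product of [H :&: N] and [P].  If [H :&: N] is inside [U],
    [card_sigma_stable] gives its order.  Otherwise an element [e x * f s] of [H]
    sends [e (1, 0)] to some [e (s, d)], as conjugation in [U] keeps first
    coordinates; so [U] is in [H], and [H :&: N] contains [U] with index 7. *)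
Lemma order_above (H : {group gT}) : PP \subset H -> e (mkU 1%R 0%R) \in H ->
  #|H| \in [:: 12; 48; 192; 1344].
Proof.
move=> sPH zH; pose V := (e @*^-1 H)%G.
have memV x : (x \in V) = (e x \in H) by rewrite !inE.
have gH : g \in H by rewrite (subsetP sPH) // mem_morphim ?cycle_id ?sigma_in_K.
have sigV (x : U) : x \in V -> sigma_fun x \in V.
  by case: x => a b; rewrite !memV -/(mkU a b) -(groupJr _ gH) eJg.
have zV : mkU 1%R 0%R \in V by rewrite memV.
have cardV : #|UU :&: H| = #|V|.
  by rewrite -morphim_setIpre setTI card_injm ?injm_sdpair1 ?subsetT.
have -> : #|H| = (#|H :&: NN| * 3)%N.
  rewrite -card_PP -TI_cardMg; last by rewrite -setIA TI_NN_PP setIg1.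
  by rewrite group_modr // defGG setIT.
have [sHU | /subsetPn[n /setIP[Hn NNn] notUn]] := boolP (H :&: NN \subset UU).
  have -> : H :&: NN = UU :&: H.
    apply/eqP; rewrite eqEsubset !subsetI subsetIl subsetIr andbT; apply/andP; split=> //=.
    exact: subset_trans (subsetIl _ _) (joing_subl UU TT).
  by rewrite cardV; have := card_sigma_stable sigV zV; rewrite !inE => /or3P[] /eqP->.
have [[a b] [s nE]] := NN_ef NNn.
have s1 : s != 1.
  by apply: contraNneq notUn => s1; rewrite nE s1 phi1 morph1 mulg1 e_UU.
have [d zn] : exists d, e (mkU 1%R 0%R) ^ n = e (mkU (val s) d).
  rewrite nE conjgM.
  have -> : e (mkU 1%R 0%R) ^ e (a, b) = e (mkU 1%R 0%R ^ mkU a b).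
    by rewrite morphJ ?inE.
  case def_u : (mkU 1%R 0%R ^ mkU a b) => [c d].
  have -> : c = 1%R.
    have := conjgC (mkU 1%R 0%R) (mkU a b).
    by rewrite def_u => /(congr1 fst) /=; rewrite addrC => /addrI.
  by exists (val s ^+ 5 * d)%R; rewrite eJf mulr1.
have Vn : mkU (val s) d \in V by rewrite memV -zn groupJ.
have VT : #|V| = 64.
  rewrite (sigma_stable_full sigV zV Vn) ?cardsT ?card_prod ?cardF //.
  rewrite sqrF_id negb_or; apply/andP; split; last by [].
  by have := valP s; rewrite unitfE.
have sUH : UU \subset H :&: NN.
  rewrite subsetI joing_subl andbT; apply/setIidPl/eqP.
  by rewrite eqEcard subsetIl cardV VT card_UU.
have gtU : #|UU| < #|H :&: NN|.
  by rewrite proper_card // properE sUH; apply/subsetPn; exists n; rewrite ?inE ?Hn.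
have [/dvdnP[k kE] dvN] := (cardSg sUH, cardSg (subsetIr H NN)).
(* [#|H :&: NN| = k * 64] divides [7 * 64], and [k > 1]. *)
move: gtU dvN; rewrite kE card_UU card_NN.
by case: k kE => [|[|[|[|[|[|[|[|k]]]]]]]] //= _ _ /dvdn_leq /=; rewrite mulSn.
Qed.

(** For [n] in [N] normalising [P], the commutator [[~ n, g]] is in both [N] and
    [P], hence trivial. *)
Lemma norm_PP : 'N(PP) \subset [set e x * p | x in [set y : U | sigma_fun y == y], p in PP].
Proof.
apply/subsetP=> h nPh; have : h \in NN * PP by rewrite defGG inE.
case/mulsgP=> n p NNn Pp hE; have nPn : n \in 'N(PP).
  by rewrite -(groupMr _ (subsetP (normG PP) _ Pp)) -hE.
have Pg : g \in PP by rewrite mem_morphim ?cycle_id ?sigma_in_K.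
have [|x xE nE] := cent_NN NNn; last by rewrite hE nE; apply/imset2P; exists x p; rewrite ?inE ?xE.
have : [~ n, g] \in NN :&: PP.
  rewrite inE {1}commgEl groupM ?groupV ?memJ_norm //= ?(subsetP (normal_norm NN_normal)) ?inE //=.
  by rewrite commgEr groupM // memJ_norm ?groupV.
by rewrite TI_NN_PP => /set1P/eqP/conjg_fixP.
Qed.

(** [order_above] applies because [sigma] fixes [(1, 0)].  For the lower bound, the
    normaliser has at most [4 * 3] elements by [norm_PP], and the orders 48, 192,
    1344 keep the next three groups of the chain apart. *)
Lemma l_p_GG : l_p 3 (G cardF t) = 3.
Proof.
rewrite (l_pE Sylow_PP); apply/eqP; rewrite eqn_leq; apply/andP; split.
  apply: (@chain_length_le_orders _ _ _ [:: 12; 48; 192; 1344]) => A sNA _.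
  apply: order_above; first by rewrite (subset_trans _ sNA) // subsetI subsetT normG.
  apply: (subsetP sNA); rewrite in_setI in_setT; apply: (subsetP (cent_sub _)).
  rewrite /= morphim_cycle ?sigma_in_K // cent_cycle; apply/cent1P/commgP/conjg_fixP.
  by rewrite eJg expr1n expr0n.
(* [W] is [GF(2) * F], the middle step of the stable subgroups of [U]. *)
pose B : {set F} := [set 0%R; 1%R].
pose W : {set U} := setX B [set: F].
have memW x y : (mkU x y \in W) = (x ^+ 2 == x)%R.
  by rewrite in_setX in_setT andbT sqrF_id !inE.
have gW : group_set W.
  apply/group_setP; split=> [|[a b] [c d]]; first by rewrite !inE eqxx.
  by rewrite !memW sqrD // => /eqP-> /eqP->.
have cardGF2 : #|B| = 2 by rewrite cards2 eq_sym oner_eq0.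
have cardW : #|e @* W| = 16.
  by rewrite card_injm ?injm_sdpair1 ?subsetT // cardsX cardsT cardF cardGF2.
pose Wg := (e @* Group gW)%G.
have nWP : PP \subset 'N(Wg).
  rewrite /= morphim_cycle ?sigma_in_K // cycle_subG inE.
  apply/subsetP=> _ /imsetP[_ /morphimP[[a b] _ Wab ->] ->].
  rewrite -[(a, b)]/(mkU a b) eJg mem_morphim ?in_setT //.
  have {Wab}: mkU a b \in W := Wab.
  by rewrite !memW => /eqP a2; rewrite !a2.
pose H1 := (Wg <*> PP)%G; pose H2 := (UU <*> PP)%G.
have cardH1 : #|H1| = 48.
  have -> : H1 = Wg * PP :> {set gT} by exact: norm_joinEr.
  by rewrite TI_cardMg ?cardW ?card_PP // coprime_TIg // cardW card_PP.
have cardH2 : #|H2| = 192.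
  have -> : H2 = UU * PP :> {set gT}.
    exact: norm_joinEr (subset_trans (subsetT _) GG_norm_UU).
  by rewrite TI_cardMg ?card_UU ?card_PP // coprime_TIg // card_UU card_PP.
pose fix_U := [set y : U | sigma_fun y == y].
have fixU : fix_U \subset setX B B.
  apply/subsetP=> -[a b]; rewrite inE => /eqP[/eqP a2 /eqP b2].
  by rewrite in_setX !inE -!sqrF_id a2 b2.
have sNH1 : 'N_[set: gT](PP) \subset H1.
  rewrite setTI; apply: subset_trans norm_PP _.
  apply/subsetP=> _ /imset2P[x p /(subsetP fixU) + Pp ->].
  case: x => a b /setXP[a2 _]; rewrite groupM //; last by rewrite mem_gen // inE Pp orbT.
  rewrite mem_gen // inE; apply/orP; left.
  by rewrite mem_morphim ?in_setT // -/(mkU a b) memW sqrF_id; rewrite !inE in a2.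
have cardN : #|'N_[set: gT](PP)| <= 12.
  rewrite setTI (leq_trans (subset_leq_card norm_PP)) // curry_imset2X.
  rewrite (leq_trans (leq_imset_card _ _)) // cardsX card_PP -[12]/(4 * 3)%N leq_mul //.
  by rewrite (leq_trans (subset_leq_card fixU)) // cardsX cardGF2.
apply: (@chain_length_ge _ _ _ [:: H1; H2; [set: gT]%G]).
rewrite /strict_chain /= eqxx !andbT; apply/and3P; split; rewrite properEcard.
- by rewrite sNH1 cardH1 (leq_ltn_trans cardN).
- by rewrite cardH1 cardH2 andbT genS // setSU // morphimS // subsetT.
- by rewrite subsetT cardH2 card_GG.
Qed.
End Structure.

Theorem theorem2p3 (F : finFieldType) (cardF : #|F| = 8) (t : {unit F})
    (gen_t : generator [set: {unit F}] t) :
  [/\ T cardF t ><| P cardF = K cardF t,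
      #|G cardF t| = (2 ^ 6 * 3 * 7)%N,
      3.-Sylow(G cardF t) (PG cardF t),
      #|Irr_p 3 (G cardF t)| = 2 &
      l_p 3 (G cardF t) = 3].
Proof.
split; first exact: sdprod_TP.
- exact: card_GG.
- exact: Sylow_PP.
- exact: card_Irr_3_GG.
- exact: l_p_GG.
Qed.
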